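(* Let $k\ge 1$ be an integer and let $\mathrm{scw}_k(x)=\sum_{n\ge 0}\mathrm{scw}_{n,k}x^n$ be the generating function for the number $\mathrm{scw}_{n,k}$ of smooth cyclic words of length $n$ over the alphabet $[k]$. Then $$\mathrm{scw}_k(x)=1+\frac{kx(1+3x)}{(1+x)(1-3x)}-\frac{2(k+1)x}{(1+x)(1-3x)}\cdot\frac{U_{k-1}\left(\frac{1-x}{2x}\right)}{U_k\left(\frac{1-x}{2x}\right)}.$$
   Context: $[k]=\{1,2,\ldots,k\}$, and $[k]^n$ is the set of words $\sigma=\sigma_1\cdots\sigma_n$ of length $n$ over $[k]$. A word $\sigma\in[k]^n$ is smooth if $|\sigma_{i+1}-\sigma_i|\le 1$ for all $1\le i\le n-1$, and smooth cyclic if it is smooth and in addition $|\sigma_n-\sigma_1|\le 1$. The empty word ($n=0$) counts as one smooth cyclic word, so $\mathrm{scw}_{0,k}=1$, and $\mathrm{scw}_{1,k}=k$. $U_r$ is the Chebyshev polynomial of the second kind, $U_r(\cos\theta)=\sin((r+1)\theta)/\sin\theta$; equivalently $U_0(t)=1$, $U_1(t)=2t$, $U_r(t)=2tU_{r-1}(t)-U_{r-2}(t)$. The right-hand side is a rational function of $x$, and the identity means that the formal power series $\mathrm{scw}_k(x)$ is the expansion of this rational function at $x=0$. *)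

(* Defs.v *)
From mathcomp Require Import all_boot all_order all_algebra.
Set Implicit Arguments.
Unset Strict Implicit.
Unset Printing Implicit Defensive.
Import Order.TTheory GRing.Theory Num.Theory.
Local Open Scope ring_scope.

(* The letter a : 'I_k stands for the letter a + 1 of [k] = {1, ..., k};
   smoothness only involves differences of letters. *)
Definition adjacent (k : nat) (a b : 'I_k) : bool :=
  (`|b%:Z - a%:Z| <= 1)%N.

Definition smooth (k : nat) (w : seq 'I_k) : bool := sorted (@adjacent k) w.

Definition smooth_cyclic (k : nat) (w : seq 'I_k) : bool :=
  smooth w && (if w is a :: s then adjacent a (last a s) else true).

Definition scw (n k : nat) : nat := #|[set w : n.-tuple 'I_k | smooth_cyclic w]|.

(* A formal power series is given by its sequence of coefficients. *)
Definition scw_gf (k : nat) : nat -> rat := fun n => (scw n k)%:R.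

Fixpoint chebyshevU (R : nzRingType) (r : nat) : {poly R} :=
  match r with
  | 0 => 1
  | r1.+1 =>
    match r1 with
    | 0 => 2%:R *: 'X
    | r2.+1 => 2%:R *: 'X * chebyshevU R r1 - chebyshevU R r2
    end
  end.

Definition ratfun : fieldType := {fraction {poly rat}}.

Definition ratfunX : ratfun := tofrac 'X.

(* The series with coefficients a is the expansion at 0 of f: f is regular at 0,
   i.e. f = p / q with q(0) <> 0, and q * a = p as formal power series (Cauchy
   product).  Since q is then invertible as a power series, a is unique. *)
Definition expansion_at0 (a : nat -> rat) (f : ratfun) : Prop :=
  exists p q : {poly rat},
    [/\ q.[0] != 0,
        f = tofrac p / tofrac q
      & forall n : nat, \sum_(i < n.+1) q`_i * a (n - i)%N = p`_n].

(* Main.v *)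
Require Import Defs.
From mathcomp Require Import all_boot all_order all_algebra.
From mathcomp Require Import perm ring zify.
Set Implicit Arguments.
Unset Strict Implicit.
Unset Printing Implicit Defensive.
Import Order.TTheory GRing.Theory Num.Theory.
Local Open Scope ring_scope.

(** For n >= 1 the smooth cyclic words of length n over [k] are the closed walks
    of length n on the path with vertices 1, ..., k and a loop at each vertex.
    Hence scw_n = tr (A^n), where A is the adjacency matrix of that graph
    ([scw_trace]).  Only n = 0 is exceptional: the empty word counts once,
    whereas tr (A^0) = k.

    With D_k = det (1 - xA), the traces of the powers of any matrix satisfy
    sum_(n >= 0) tr (A^n) x^n = k - x D_k' / D_k.  This is Newton's identity
    [newton_trace]; its two ingredients are the power series expansion of the
    resolvent, D_k (1 - xA)^-1 = adj (1 - xA), and Jacobi's formula for the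
    derivative of a determinant.  Replacing the constant term k by 1 gives
    scw_k(x) = (D_k - x D_k') / D_k, and D_k(0) = 1, so these are the numerator
    and the denominator of the expansion at 0.

    It remains to rewrite this fraction.  Since A is tridiagonal,
    D_(k+2) = (1 - x) D_(k+1) - x^2 D_k ([transfer_poly_rec]), which is the
    Chebyshev recurrence rescaled: D_k = x^k U_k((1 - x)/(2x))
    ([chebyshevU_rescaled]).  With t = (1 - x)/(2x), so that
    (1 + x)(1 - 3x) = 4x^2 (t^2 - 1), the classical identity
    (1 - t^2) U_k'(t) = (k + 1) U_(k-1)(t) - k t U_k(t) becomes
    (1 + x)(1 - 3x) D_k' = 2(k + 1) x D_(k-1) - k (1 + 3x) D_k
    ([transfer_poly_deriv]), and substituting it yields the formula. *)

(** * Newton's identity for traces of powers *)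

Lemma deriv_prod (R : comNzRingType) (I : eqType) (r : seq I)
    (F : I -> {poly R}) : uniq r ->
  (\prod_(i <- r) F i)^`()
    = \sum_(i <- r) (F i)^`() * \prod_(j <- r | j != i) F j.
Proof.
elim: r => [|a r IHr] /=; first by rewrite !big_nil derivC.
case/andP=> ar ur; rewrite !big_cons derivM IHr // eqxx /=; congr (_ * _ + _).
  rewrite big_seq [RHS]big_seq_cond; apply: eq_bigl => j.
  by case: eqP => [->|_]; rewrite ?(negPf ar) ?andbT.
rewrite mulr_sumr [LHS]big_seq [RHS]big_seq; apply: eq_bigr => i ir.
rewrite big_cons; case: eqP => [eai|_]; first by rewrite eai ir in ar.
by rewrite mulrCA.
Qed.

(** Jacobi's formula.  Differentiating the Leibniz expansion factor by factor
    and grouping the permutations s by the value j = s i at the differentiated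
    row i leaves, as coefficient of the derivative of M i j, its cofactor. *)
Lemma deriv_det (R : comNzRingType) (n : nat) (M : 'M[{poly R}]_n) :
  (\det M)^`() = \tr (map_mx (@deriv R) M *m \adj M).
Proof.
rewrite /determinant (raddf_sum (@deriv R)) /=.
under eq_bigr => s _.
  have -> : ((-1) ^+ s * \prod_i M i (s i))^`() =
     \sum_i (M i (s i))^`() * ((-1) ^+ s * \prod_(k | i != k) M k (s k)).
    have -> p : ((-1) ^+ s * p)^`() = (-1) ^+ s * p^`() :> {poly R}.
      by case: (s : bool); rewrite ?expr0 ?expr1 ?mul1r // !mulN1r derivN.
    rewrite deriv_prod ?index_enum_uniq // mulr_sumr; apply: eq_bigr => i _.
    by rewrite mulrCA; under eq_bigl => j do rewrite eq_sym.
  over.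
rewrite exchange_big; apply: eq_bigr => i _; rewrite mxE.
rewrite (partition_big (fun s : {perm 'I_n} => s i) predT) //=.
apply: eq_bigr => j _; rewrite !mxE expand_cofactor mulr_sumr.
by apply: eq_bigr => s /eqP ->.
Qed.

(** The reciprocal of the characteristic polynomial. *)
Definition revchar (R : comNzRingType) (n : nat) (A : 'M[R]_n) : {poly R} :=
  \det (1%:M - 'X *: map_mx polyC A).

(** B = q (1 - xA)^-1 is, as a power series, q times the geometric series of xA.
    Comparing coefficients in B = q + x A B avoids inverting anything. *)
Lemma resolvent_coef (R : comNzRingType) (k : nat) (A : 'M[R]_k)
    (B : 'M[{poly R}]_k) (q : {poly R}) (n : nat) :
    (1%:M - 'X *: map_mx polyC A) *m B = q%:M ->
  map_mx (coefp n) B = \sum_(i < n.+1) q`_i *: A ^+ (n - i).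
Proof.
move=> MB.
have Bcoef m : map_mx (coefp m) B =
    (if m is m'.+1 then A *m map_mx (coefp m') B else 0) + (q`_m)%:M.
  apply/matrixP=> i j; rewrite !mxE /coefp.
  have -> : B i j = q%:M i j + 'X * (map_mx polyC A *m B) i j.
    by rewrite -MB mulmxBl mul1mx -scalemxAl !mxE subrK.
  rewrite !mxE coefD addrC coefXM coefMn; congr (_ + _).
  case: m => [|m] /=; first by rewrite mxE.
  by rewrite coef_sum mxE; apply: eq_bigr => l _; rewrite !mxE coefCM.
elim: n => [|n IHn]; rewrite Bcoef.
  by rewrite big_ord1 add0r expr0 scalemx1.
rewrite big_ord_recr /= subnn expr0 scalemx1 IHn mulmx_sumr; congr (_ + _).
apply: eq_bigr => i _; rewrite subSn ?exprS -?scalemxAr //.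
by rewrite -ltnS.
Qed.

(** Both sides are the coefficient of x^n in the trace of adj (1 - xA): the left
    one by the expansion of the resolvent, the right one because
    x (1 - xA)' = (1 - xA) - 1 turns Jacobi's formula into
    x q' = k q - tr (adj (1 - xA)). *)
Lemma newton_trace (R : comNzRingType) (k : nat) (A : 'M[R]_k) (n : nat) :
  \sum_(i < n.+1) (revchar A)`_i * \tr (A ^+ (n - i))
    = k%:R * (revchar A)`_n - n%:R * (revchar A)`_n.
Proof.
set q := revchar A; set M := 1%:M - 'X *: map_mx polyC A.
have -> : \sum_(i < n.+1) q`_i * \tr (A ^+ (n - i)) = (\tr (\adj M))`_n.
  transitivity (\tr (map_mx (coefp n) (\adj M))).
    rewrite (resolvent_coef n (mul_mx_adj M)) raddf_sum.
    by apply: eq_bigr => i _; rewrite /= mxtraceZ.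
  by rewrite coef_sum; apply: eq_bigr => i _; rewrite mxE.
have -> : \tr (\adj M) = q *+ k - 'X * q^`().
  have XM : 'X *: map_mx (@deriv R) M = M - 1%:M.
    apply/matrixP=> i j; rewrite !mxE derivD derivN derivM derivX derivC.
    by rewrite derivMn derivC mulr0 addr0 mul0rn mul1r add0r mulrN addrC addKr.
  rewrite /q /revchar -/M deriv_det -mxtraceZ scalemxAl XM mulmxBl mul1mx.
  by rewrite mul_mx_adj raddfB /= mxtrace_scalar opprB addrC subrK.
rewrite coefB coefMn coefXM coef_deriv; case: n => [|n].
  by rewrite mul0r mulr_natl.
by rewrite !mulr_natl.
Qed.

(** * Smooth cyclic words as closed walks *)

Definition adjmx (R : comNzRingType) (k : nat) : 'M[R]_k :=
  \matrix_(a, b) (adjacent a b)%:R.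

Lemma big_tuple_recl (R : nmodType) (T : finType) (n : nat)
    (F : n.+1.-tuple T -> R) :
  \sum_w F w = \sum_c \sum_(w : n.-tuple T) F [tuple of c :: w].
Proof.
rewrite pair_bigA.
rewrite (reindex (fun p : T * n.-tuple T => [tuple of p.1 :: p.2])) //=.
exists (fun w : n.+1.-tuple T => (thead w, [tuple of behead w])).
  by case=> c w _; congr (_, _); apply: val_inj.
by move=> w _; rewrite /= [in RHS](tuple_eta w).
Qed.

Lemma adjacent_sym k (a b : 'I_k) : adjacent a b = adjacent b a.
Proof. by rewrite /adjacent distnC. Qed.

(** The (a, b) entry of A^n counts the walks of length n from a to b.  Taking for
    f the adjacency to a given letter yields the closing step of a cyclic word. *)
Lemma sum_path_adjmx (R : comNzRingType) (k n : nat) (a : 'I_k)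
    (f : 'I_k -> R) :
  \sum_(w : n.-tuple 'I_k) (path (@adjacent k) a w)%:R * f (last a w)
    = \sum_b (adjmx R k ^+ n) a b * f b.
Proof.
elim: n a => [|n IHn] a.
  rewrite (big_pred1 [tuple]) => [|w]; last by rewrite (tuple0 w) /= eqxx.
  rewrite (bigD1 a) //= big1 ?addr0 => [|b ba]; rewrite !mxE ?eqxx //.
  by rewrite eq_sym (negPf ba) mul0r.
rewrite big_tuple_recl.
transitivity (\sum_c \sum_b adjmx R k a c * ((adjmx R k ^+ n) c b * f b)).
  apply: eq_bigr => c _; rewrite -mulr_sumr -IHn mulr_sumr mxE.
  by apply: eq_bigr => w _; rewrite /= mulrA -natrM mulnb.
rewrite exchange_big; apply: eq_bigr => b _; rewrite exprS mxE mulr_suml.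
by apply: eq_bigr => c _; rewrite mulrA.
Qed.

Lemma scw_trace (R : comNzRingType) (k n : nat) :
  (scw n.+1 k)%:R = \tr (adjmx R k ^+ n.+1).
Proof.
transitivity (\sum_(a : 'I_k) \sum_(w : n.-tuple 'I_k)
    (path (@adjacent k) a w)%:R * (adjacent (last a w) a)%:R : R).
  rewrite /scw -sum1_card natr_sum big_mkcond big_tuple_recl /=.
  apply: eq_bigr => a _; apply: eq_bigr => w _.
  rewrite inE /smooth_cyclic /smooth /= adjacent_sym -natrM mulnb.
  by case: ifP.
apply: eq_bigr => a _.
rewrite (sum_path_adjmx n a (fun b => (adjacent b a)%:R)) exprSr mxE.
by apply: eq_bigr => b _; rewrite [adjmx R k b a]mxE.
Qed.

(** * The determinant of the transfer matrix *)

Definition transfer_poly (R : comNzRingType) (k : nat) : {poly R} :=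
  revchar (adjmx R k).

(** Expansion along the first row, which has only two nonzero entries; the
    second minor is then expanded along its first column, which has only one.
    Deleting the first one or two letters leaves the same matrix for a smaller
    alphabet. *)
Lemma transfer_poly_rec (R : comNzRingType) (k : nat) :
  transfer_poly R k.+2
    = (1 - 'X) * transfer_poly R k.+1 - 'X^2 * transfer_poly R k.
Proof.
have adjE m (a b : 'I_m) : adjacent a b = (a <= b.+1)%N && (b <= a.+1)%N.
  by rewrite /adjacent; lia.
pose M m : 'M[{poly R}]_m := 1%:M - 'X *: map_mx polyC (adjmx R m).
have ME m (a b : 'I_m) : M m a b = (a == b)%:R - 'X * (adjacent a b)%:R.
  by rewrite !mxE rmorph_nat.
rewrite /transfer_poly /revchar -!/(M _) (expand_det_row _ ord0) !big_ord_recl.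
rewrite big1 ?addr0 => [|j _]; last first.
  by rewrite ME adjE /= mulr0 subr0 mul0r.
rewrite !ME !adjE /= mulr1 sub0r /cofactor /= expr0 mul1r.
congr (_ * _ + _).
  by congr (\det _); apply/matrixP=> a b; rewrite !mxE !rmorph_nat !adjE.
set N := row' _ _.
have NE i : N i ord0 = - 'X * (i == ord0)%:R.
  rewrite !mxE rmorph_nat adjE /=.
  by case: i => -[|i] //= _; rewrite sub0r mulNr.
rewrite (expand_det_col _ ord0) big_ord_recl big1 ?addr0 => [|i _]; last first.
  by rewrite NE /= mulr0 mul0r.
rewrite NE /cofactor /=.
have -> : row' ord0 (col' ord0 N) = M k.
  by apply/matrixP=> a b; rewrite !mxE !rmorph_nat !adjE.
by ring.
Qed.

Lemma transfer_poly0 (R : comNzRingType) : transfer_poly R 0 = 1.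
Proof. exact: det_mx00. Qed.

Lemma transfer_poly1 (R : comNzRingType) : transfer_poly R 1 = 1 - 'X.
Proof.
by rewrite /transfer_poly /revchar det_mx11 !mxE /adjacent subrr /= mulr1.
Qed.

Lemma revchar_at0 (R : comNzRingType) (k : nat) (A : 'M[R]_k) :
  (revchar A).[0] = 1.
Proof.
rewrite -[LHS]/(horner_eval 0 _) -det_map_mx -[RHS](det1 R k).
congr (\det _); apply/matrixP=> i j.
by rewrite !mxE /= /horner_eval !hornerE hornerMn hornerC subr0.
Qed.

Lemma two_step_ind (P : nat -> Prop) :
  P 0%N -> P 1%N -> (forall n, P n -> P n.+1 -> P n.+2) -> forall n, P n.
Proof.
move=> P0 P1 PS n; suff: P n /\ P n.+1 by case.
by elim: n => // n [Pn PSn]; split; last exact: PS.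
Qed.

(** Differentiating the recurrence brings in the derivatives at the two previous
    indices; their closed forms involve D0, D1, D2 only, and D0 is eliminated
    because it comes with the factor x^2 that the recurrence provides. *)
Lemma transfer_poly_deriv (R : comNzRingType) (k : nat) :
  (1 + 'X) * (1 - 3%:R * 'X) * (transfer_poly R k.+1)^`()
    = 2%:R * k.+2%:R * 'X * transfer_poly R k
      - k.+1%:R * (1 + 3%:R * 'X) * transfer_poly R k.+1.
Proof.
have derivX2 : ('X^2)^`() = 'X *+ 2 :> {poly R} by rewrite derivXn.
elim/two_step_ind: k => [||k IH0 IH1].
- by rewrite transfer_poly0 transfer_poly1 derivB derivC derivX; ring.
- rewrite transfer_poly_rec transfer_poly0 transfer_poly1.
  by rewrite !(derivB, derivM, derivC, derivX, derivX2); ring.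
have recS := transfer_poly_rec R k.+1; have rec := transfer_poly_rec R k.
move: (transfer_poly R k.+3) (transfer_poly R k.+2) (transfer_poly R k.+1)
  (transfer_poly R k) IH0 IH1 rec recS => D3 D2 D1 D0 IH0 IH1 rec ->.
have -> : (1 + 'X) * (1 - 3%:R * 'X) * ((1 - 'X) * D2 - 'X^2 * D1)^`()
  = (1 - 'X) * ((1 + 'X) * (1 - 3%:R * 'X) * D2^`())
    - 'X^2 * ((1 + 'X) * (1 - 3%:R * 'X) * D1^`())
    - (1 + 'X) * (1 - 3%:R * 'X) * (D2 + 'X *+ 2 * D1).
  by rewrite !(derivB, derivM, derivC, derivX, derivX2); ring.
rewrite IH0 IH1.
have E0 : 'X^2 * D0 = (1 - 'X) * D1 - D2 by rewrite rec; ring.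
have -> : 'X^2 * (2%:R * k.+2%:R * 'X * D0 - k.+1%:R * (1 + 3%:R * 'X) * D1)
  = 2%:R * k.+2%:R * 'X * ('X^2 * D0)
    - 'X^2 * (k.+1%:R * (1 + 3%:R * 'X) * D1) by ring.
by rewrite E0; ring.
Qed.

(** * The rational function *)

(** With 1 - x = 2 x t, multiplying the Chebyshev recurrence at t by x^(k+2)
    gives the recurrence of d. *)
Lemma chebyshevU_rescaled (F : fieldType) (x : F) (d : nat -> F) :
    x != 0 -> 2%:R != 0 :> F -> d 0%N = 1 -> d 1%N = 1 - x ->
    (forall k, d k.+2 = (1 - x) * d k.+1 - x ^+ 2 * d k) ->
  forall k, d k = x ^+ k * (chebyshevU F k).[(1 - x) / (2%:R * x)].
Proof.
move=> x0 two0 d0 d1 drec.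
set t := _ / _.
have tx : 1 - x = x * (2%:R * t) by rewrite /t; field; rewrite x0.
clearbody t; elim/two_step_ind => [||k IH0 IH1].
- by rewrite d0 /= hornerC mulr1.
- by rewrite d1 tx /= !hornerE.
rewrite drec IH0 IH1 tx.
rewrite -[chebyshevU F k.+2]/(2%:R *: 'X * chebyshevU F k.+1 - chebyshevU F k).
rewrite hornerD hornerN hornerM hornerZ hornerX !exprS.
move: (chebyshevU F k.+1).[t] (chebyshevU F k).[t] => u1 u0.
by ring.
Qed.

(** Here d, d' and dd stand for D_(k+1), D_k and the derivative of D_(k+1), and
    u, u' for the values of U_(k+1) and U_k at t. *)
Lemma logderiv_chebyshev_form (F : fieldType) (k : nat) (x d' d dd u' u : F) :
    x != 0 -> d != 0 -> 1 + x != 0 -> 1 - 3%:R * x != 0 ->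
    d' = x ^+ k * u' -> d = x ^+ k.+1 * u ->
    (1 + x) * (1 - 3%:R * x) * dd
      = 2%:R * k.+2%:R * x * d' - k.+1%:R * (1 + 3%:R * x) * d ->
  1 + k.+1%:R * x * (1 + 3%:R * x) / ((1 + x) * (1 - 3%:R * x))
     - 2%:R * k.+2%:R * x / ((1 + x) * (1 - 3%:R * x)) * (u' / u)
  = (d - x * dd) / d.
Proof.
move=> x0 dn0 w1 w2 ed' ed edd.
have u0 : u != 0 by apply: contraNneq dn0 => u0; rewrite ed u0 mulr0.
have -> : u' / u = x * d' / d.
  rewrite ed' ed exprS; field; rewrite x0 u0 /=.
  by rewrite expf_neq0.
have -> : dd = (2%:R * k.+2%:R * x * d' - k.+1%:R * (1 + 3%:R * x) * d)
    / ((1 + x) * (1 - 3%:R * x)).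
  by rewrite -edd; field; rewrite w1 w2.
by field; rewrite w1 w2 dn0.
Qed.

Theorem theorem3p2 (k : nat) (hk : (1 <= k)%N) :
  let x : ratfun := ratfunX in
  let t : ratfun := (1 - x) / (2%:R * x) in
  expansion_at0 (scw_gf k)
    (1 + k%:R * x * (1 + 3%:R * x) / ((1 + x) * (1 - 3%:R * x))
     - 2%:R * (k.+1)%:R * x / ((1 + x) * (1 - 3%:R * x))
       * ((chebyshevU ratfun k.-1).[t] / (chebyshevU ratfun k).[t])).
Proof.
move=> x t; case: k hk => // k _.
pose D := transfer_poly rat.
have natE n : tofrac (n%:R : {poly rat}) = n%:R :> ratfun by rewrite rmorph_nat.
have nz0 (p : {poly rat}) : p.[0] != 0 -> tofrac p != 0 :> ratfun.
  by rewrite tofrac_eq0; apply: contraNneq => ->; rewrite horner0.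
exists (D k.+1 - 'X * (D k.+1)^`()), (D k.+1); split.
- by rewrite revchar_at0 oner_neq0.
- have chebE m : tofrac (D m) = x ^+ m * (chebyshevU ratfun m).[t] :> ratfun.
    move: m; apply: (@chebyshevU_rescaled ratfun x (fun m => tofrac (D m))).
    + by rewrite tofrac_eq0 polyX_eq0.
    + by rewrite -natE nz0 // -polyC_natr hornerC.
    + by rewrite /D transfer_poly0 tofrac1.
    + by rewrite /D transfer_poly1 tofracB tofrac1.
    + move=> m; rewrite /D transfer_poly_rec !expr2 tofracB !tofracM.
      by rewrite tofracB tofrac1.
  rewrite tofracB tofracM -/ratfunX -/x -[k.+1.-1]/k.
  apply: (@logderiv_chebyshev_form ratfun k x (tofrac (D k))).
  + by rewrite tofrac_eq0 polyX_eq0.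
  + by rewrite nz0 // revchar_at0 oner_neq0.
  + by rewrite -tofrac1 -tofracD nz0 // !hornerE oner_neq0.
  + rewrite -tofrac1 -natE -tofracM -tofracB nz0 // -polyC_natr !hornerE.
    by rewrite ?mulr0 ?subr0 oner_neq0.
  + exact: chebE.
  + exact: chebE.
  + have := congr1 (@tofrac _) (transfer_poly_deriv rat k).
    by rewrite !(tofracB, tofracD, tofracM, tofrac1, natE).
move=> n; have := newton_trace (adjmx rat k.+1) n; rewrite -/(D k.+1).
(* The terms i = n are split off: there the series has 1, the trace has k + 1. *)
rewrite !big_ord_recr /= subnn expr0 mxtrace1 => newton.
rewrite coefB coefXM coef_deriv.
have -> : scw_gf k.+1 0 = 1.
  rewrite /scw_gf /scw (eq_card1 (x := [tuple])) // => w.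
  by rewrite inE (tuple0 w); exact/esym/eqxx.
transitivity ((D k.+1)`_n - n%:R * (D k.+1)`_n); last first.
  by case: n {newton} => [|n]; rewrite ?mul0r // mulr_natl.
have -> : \sum_(i < n) (D k.+1)`_i * scw_gf k.+1 (n - i)
    = \sum_(i < n) (D k.+1)`_i * \tr (adjmx rat k.+1 ^+ (n - i)).
  apply: eq_bigr => i _; rewrite /scw_gf -[(n - i)%N]prednK ?subn_gt0 //.
  by rewrite -scw_trace.
move: newton; set S := \sum_(i < n) _ => newton.
by rewrite -[S](addrK ((D k.+1)`_n * k.+1%:R)) newton; ring.
Qed.
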